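(* Let $s \geq 2$ and $e_1, \ldots, e_s \geq 2$ be integers. Let $\mathscr{P}$ be a set of size $v = \prod_{i=1}^s e_i$ with a chain of partitions $\mathscr{C}_0 \prec \mathscr{C}_1 \prec \cdots \prec \mathscr{C}_s$ of $\mathscr{P}$, where $\mathscr{C}_0$ is the partition into singletons, $\mathscr{C}_s=\{\mathscr{P}\}$, and for each $1\le i\le s$ each class of $\mathscr{C}_i$ contains exactly $e_i$ classes of $\mathscr{C}_{i-1}$. Let $\mathscr{D} = (\mathscr{P},\mathscr{B})$, where $\mathscr{B} = B^G=\{B^g\mid g\in G\}$ for some $k$-subset $B$ of $\mathscr{P}$ and some subgroup $G \leq S_{e_1} \wr \ldots \wr S_{e_s}$ that leaves invariant the chain. For a class $C$ of any $\mathscr{C}_i$ put $x_C := |B\cap C|$, and for $C\in\mathscr{C}_{i-1}$ let $C^+$ denote the unique $\mathscr{C}_i$-class containing $C$. If $\mathscr{D}$ is a $G$-block-transitive, $(G,s)$-chain-imprimitive $2$-design then $$\sum_{C \in \mathscr{C}_1} x_{C} \left( x_{C} - 1 \right) = \frac{k(k-1)}{v-1} (e_1 - 1)$$ and $$\sum_{C \in \mathscr{C}_{i-1}} x_C \left( x_{C^+} - x_C \right) = \frac{k(k-1)}{v-1} (e_i - 1) \prod_{j \leq i-1} e_j \quad \text{for each } i \in \{2, \ldots, s\}.$$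
   Context: A $2$-design is a pair $\mathscr{D}=(\mathscr{P},\mathscr{B})$ with $\mathscr{P}$ a set of $v$ points and $\mathscr{B}$ a set of $k$-element subsets of $\mathscr{P}$ (blocks), such that every set of $2$ distinct points is contained in exactly $\lambda$ blocks, for some constant $\lambda$. An automorphism of $\mathscr{D}$ is a permutation of $\mathscr{P}$ preserving $\mathscr{B}$. $\mathscr{D}$ is $G$-block-transitive if $G\leq \mathrm{Aut}(\mathscr{D})$ is transitive on $\mathscr{B}$. For partitions of $\mathscr{P}$, $\mathscr{C}'\prec\mathscr{C}$ means that each part of $\mathscr{C}'$ is a subset of some part of $\mathscr{C}$ with at least one inclusion proper. For $s\ge 2$, $G\leq\mathrm{Sym}(\mathscr{P})$ is $s$-chain-imprimitive on $\mathscr{P}$ if $G$ is transitive on $\mathscr{P}$ and there exist $G$-invariant partitions $\mathscr{C}_0\prec\mathscr{C}_1\prec\cdots\prec\mathscr{C}_s$ with $\mathscr{C}_0$ the partition into singletons and $\mathscr{C}_s=\{\mathscr{P}\}$. A design $\mathscr{D}$ with point set $\mathscr{P}$ is $(G,s)$-chain-imprimitive if $G\leq \mathrm{Aut}(\mathscr{D})$ acts $s$-chain-imprimitively on $\mathscr{P}$. The iterated wreath product $S_{e_1} \wr \ldots \wr S_{e_s}$ acts on $\mathscr{P}$ as the full stabiliser of the chain in $\mathrm{Sym}(\mathscr{P})$, i.e. the group of all permutations of $\mathscr{P}$ leaving each $\mathscr{C}_i$ invariant. *)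

(* Defs.v *)
From HB Require Import structures.
From mathcomp Require Import all_boot all_order all_algebra all_fingroup.

Set Implicit Arguments.
Unset Strict Implicit.
Unset Printing Implicit Defensive.

Import GroupScope.

(* A design is given by its block set [Bs]; its points are all elements of     *)
(* [T]. The action ['P^*] is the action of permutations of [T] on subsets.     *)

Definition is_2design (T : finType) (k : nat) (Bs : {set {set T}}) : Prop :=
  (forall B : {set T}, B \in Bs -> #|B| = k) /\
  (exists lambda : nat, forall A : {set T}, #|A| = 2 ->
     #|[set B in Bs | A \subset B]| = lambda).

Definition design_Aut (T : finType) (Bs : {set {set T}}) : {set {perm T}} :=
  'N(Bs | 'P^*).

Definition block_transitive (T : finType) (G : {group {perm T}})
    (Bs : {set {set T}}) : Prop :=
  G \subset design_Aut Bs /\ [transitive G, on Bs | 'P^*].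

Definition prec (T : finType) (P Q : {set {set T}}) : Prop :=
  (forall A, A \in P -> exists2 D, D \in Q & A \subset D) /\
  (exists2 A, A \in P & exists2 D, D \in Q & A \proper D).

(* Only the values [C 0, ..., C s] are relevant. *)
Definition partition_chain (T : finType) (s : nat) (C : nat -> {set {set T}})
    : Prop :=
  [/\ forall i, i <= s -> partition (C i) [set: T],
      C 0 = [set [set x] | x : T],
      C s = [set [set: T]]
    & forall i, i < s -> prec (C i) (C i.+1)].

(* Only the values [e 1, ..., e s] are relevant. *)
Definition chain_degrees (T : finType) (s : nat) (e : nat -> nat)
    (C : nat -> {set {set T}}) : Prop :=
  forall i, 1 <= i <= s -> forall D, D \in C i ->
    #|[set A in C i.-1 | A \subset D]| = e i.

Definition chain_imprimitive (T : finType) (s : nat) (G : {group {perm T}})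
    : Prop :=
  [/\ 2 <= s, [transitive G, on [set: T] | 'P]
    & exists2 C : nat -> {set {set T}}, partition_chain s C
        & forall i, i <= s -> [acts G, on C i | 'P^*]].

Definition design_chain_imprimitive (T : finType) (s : nat)
    (G : {group {perm T}}) (Bs : {set {set T}}) : Prop :=
  G \subset design_Aut Bs /\ chain_imprimitive s G.

(* The iterated wreath product, as the full stabiliser in [Sym(T)] of the      *)
(* chain [C 0, ..., C s].                                                      *)
Definition chain_wreath (T : finType) (s : nat) (C : nat -> {set {set T}})
    : {set {perm T}} :=
  \bigcap_(i < s.+1) 'N(C i | 'P^*).

(* The class of [Q] containing [A]; the default [set0] is never used when [A]  *)
(* is a class of a partition refining [Q].                                     *)
Definition upclass (T : finType) (Q : {set {set T}}) (A : {set T}) : {set T} :=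
  odflt set0 [pick D in Q | A \subset D].

Lemma upclass_unique (T : finType) (P Q : {set {set T}}) (A D : {set T}) :
    partition P [set: T] -> partition Q [set: T] ->
    A \in P -> D \in Q -> A \subset D -> upclass Q A = D.
Proof.
move=> /and3P[_ _ P0] /and3P[_ trQ _] PA QD sAD; rewrite /upclass.
have /set0Pn[x Ax] : A != set0 by apply: contraNneq P0 => <-.
case: pickP => [E /andP[QE sAE] /=|/(_ D)]; last by rewrite QD sAD.
by rewrite -(def_pblock trQ QE (subsetP sAE x Ax))
           (def_pblock trQ QD (subsetP sAD x Ax)).
Qed.

(* Main.v *)
(* Let [G] preserve a partition of the points into classes of size [m]. Every *)
(* block then contains the same number [n] of ordered pairs of distinct points *)
(* from a common class, and double counting gives [n (v-1) = k (k-1) (m-1)].   *)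
(* Apply this to each [C i], whose classes have size [e 1 ... e i]: the first  *)
(* equation is the case [i = 1], and the left-hand side of the second is the   *)
(* difference of the counts [n] for [C i] and [C i.-1].                        *)
Require Import Defs.
From HB Require Import structures.
From mathcomp Require Import all_boot all_order all_algebra all_fingroup.
From mathcomp Require Import ring.

Set Implicit Arguments.
Unset Strict Implicit.
Unset Printing Implicit Defensive.

Import GRing.Theory.
Local Open Scope ring_scope.

(** The count of pairs is the same for all blocks because they form one [G]-orbit and [G] permutes
    the classes ([sum_card_pairs_act]); its total over the blocks is fixed by [l]
    ([sum_card_pairs_2design]). For consecutive partitions, [sum_card_upclass] turns the mixed
    products into squares, so the second equation is a difference of two sums of squares. *)

Lemma sum_nat_cardI (T : finType) (A B : {set T}) :
  (\sum_(a in A) (a \in B) = #|B :&: A|)%N.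
Proof.
rewrite -sum1_card big_mkcond [RHS]big_mkcond; apply: eq_bigr => a _.
by rewrite inE andbC; case: (a \in A); case: (a \in B).
Qed.

Lemma card_ordered_pairs (T : finType) (Y : {set T}) :
  (\sum_(a in Y) \sum_(b in Y :\ a) 1 = #|Y| * #|Y|.-1)%N.
Proof.
rewrite -sum_nat_const; apply: eq_bigr => a Ya.
by rewrite sum1_card (cardsD1 a Y) Ya.
Qed.

(** Triples of a block and two distinct points of [A] in it are counted by blocks and by pairs. *)
Lemma sum_card_pairs_2design (T : finType) (Bs : {set {set T}}) (l : nat)
    (A : {set T}) :
    (forall S : {set T}, #|S| = 2%N -> #|[set X in Bs | S \subset X]| = l) ->
  (\sum_(X in Bs) #|X :&: A| * #|X :&: A|.-1 = l * (#|A| * #|A|.-1))%N.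
Proof.
move=> hl.
transitivity (\sum_(X in Bs) \sum_(a in A) \sum_(b in A :\ a)
                ([set a; b] \subset X))%N.
  apply: eq_bigr => X _; rewrite -card_ordered_pairs.
  rewrite big_mkcond [RHS]big_mkcond; apply: eq_bigr => a _.
  rewrite inE andbC; case: (a \in A) => //=.
  case: ifP => aX; last first.
    by rewrite big1 // => b _; rewrite subUset sub1set aX.
  rewrite big_mkcond [RHS]big_mkcond; apply: eq_bigr => b _.
  rewrite !inE subUset !sub1set aX /=.
  by case: (b == a); case: (b \in A); case: (b \in X).
rewrite exchange_big /= -card_ordered_pairs big_distrr; apply: eq_bigr => a _.
rewrite exchange_big /= big_distrr; apply: eq_bigr => b.
rewrite !inE => /andP[ba _]; rewrite /= muln1 -(hl [set a; b]); last first.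
  by rewrite cards2 eq_sym ba.
rewrite -sum1_card big_mkcond [RHS]big_mkcond; apply: eq_bigr => X _.
by rewrite inE; case: (X \in Bs) => //=; case: (_ \subset X).
Qed.

(** The classes of [P] inside [D] partition [D]. *)
Lemma sum_cardI_refinement (T : finType) (P Q : {set {set T}})
    (B D : {set T}) :
    partition P [set: T] -> partition Q [set: T] ->
    (forall A, A \in P -> exists2 E, E \in Q & A \subset E) -> D \in Q ->
  (\sum_(A in P | A \subset D) #|B :&: A| = #|B :&: D|)%N.
Proof.
move=> pP pQ refPQ QD.
have [/eqP covP tP P0] := and3P pP; have [_ tQ _] := and3P pQ.
have pD : partition [set A in P | A \subset D] D.
  apply/and3P; split.
  - apply/eqP/setP => a; apply/bigcupP/idP => [[A]|Da].
      by rewrite inE => /andP[_ /subsetP]; apply.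
    have aP : a \in cover P by rewrite covP.
    exists (pblock P a); last by rewrite mem_pblock.
    rewrite inE pblock_mem //=.
    (* The class of [P] at [a] lies in some [E] of [Q]; [E] and [D] share [a], so they coincide. *)
    have [E QE sE] := refPQ _ (pblock_mem aP).
    have aE : a \in E by rewrite (subsetP sE) ?mem_pblock.
    by rewrite -(def_pblock tQ QD Da) (def_pblock tQ QE aE).
  - by apply: trivIsetS tP; apply/subsetP => A; rewrite inE => /andP[].
  - by rewrite inE (negPf P0).
rewrite -(sum_nat_cardI D B) (set_partition_big _ pD) /=.
by apply: eq_big => [A|A _]; rewrite ?inE ?sum_nat_cardI.
Qed.

Lemma sum_card_pairs_act (T : finType) (P : {set {set T}}) (X : {set T})
    (g : {perm T}) :
    g \in ('N(P | 'P^*))%g ->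
  (\sum_(A in P) #|('P^*)%act X g :&: A| * #|('P^*)%act X g :&: A|.-1
   = \sum_(A in P) #|X :&: A| * #|X :&: A|.-1)%N.
Proof.
move=> gP; have injg : injective (fun A : {set T} => ('P^*)%act A g).
  exact: act_inj.
rewrite (reindex_inj injg) /=; apply: eq_big => [A|A _].
  exact: (astabs_act A gP).
have -> : #|('P^*)%act X g :&: ('P^*)%act A g| = #|X :&: A|; last by [].
rewrite /= /setact -imsetI ?card_imset //; first exact: act_inj.
by move=> a b _ _; apply: act_inj.
Qed.

Lemma card_chain_class (T : finType) (s : nat) (e : nat -> nat)
    (C : nat -> {set {set T}}) :
    partition_chain s C -> chain_degrees s e C ->
  forall i, (i <= s)%N -> forall D, D \in C i ->
    #|D| = (\prod_(1 <= j < i.+1) e j)%N.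
Proof.
move=> [pC C0 _ precC] hCe; elim=> [_ D|i IHi lt_is D CD].
  by rewrite C0 big_geq // => /imsetP[a _ ->]; rewrite cards1.
rewrite big_nat_recr //= -(hCe i.+1 _ D CD) //= mulnC.
(* With [[set: T]] in the role of [B], the refinement lemma counts the points of [D]. *)
rewrite -[D in LHS]setTI.
rewrite -(sum_cardI_refinement _ (pC _ (ltnW lt_is)) (pC _ lt_is) _ CD);
  last by case: (precC i lt_is).
rewrite -sum_nat_const; apply: eq_big => [A|A /andP[CA _]]; first by rewrite inE.
by rewrite setTI IHi // ltnW.
Qed.

(* Double counting of the triples [(X, a, b)] with [X] a block and [a], [b]   *)
(* distinct points of [X] lying in a common class of [P]; [P = {T}] eliminates *)
(* [lambda].                                                                  *)
Lemma sum_card_pairs_invariant_partition (T : finType) (k : nat)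
    (G : {group {perm T}}) (B : {set T}) (P : {set {set T}}) (m : nat) :
    is_2design k (orbit ('P^*)%act G B) -> G \subset ('N(P | 'P^*))%g ->
    partition P [set: T] -> (forall A, A \in P -> #|A| = m) ->
  ((\sum_(A in P) #|B :&: A| * #|B :&: A|.-1) * #|T|.-1
   = k * k.-1 * m.-1)%N.
Proof.
set Bs := orbit _ _ _ => -[hk [l hl]] GP pP hm; set n := (\sum_(A in P) _)%N.
have nBs : (#|Bs| * n = l * (#|T| * m.-1))%N.
  transitivity (\sum_(X in Bs) \sum_(A in P) #|X :&: A| * #|X :&: A|.-1)%N.
    rewrite -sum_nat_const; apply: eq_bigr => X /orbitP[g Gg <-].
    by rewrite sum_card_pairs_act // (subsetP GP).
  rewrite exchange_big /= -cardsT (card_partition pP) big_distrl big_distrr /=.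
  by apply: eq_bigr => A PA; rewrite (sum_card_pairs_2design _ hl) (hm A PA).
have kBs : (#|Bs| * (k * k.-1) = l * (#|T| * #|T|.-1))%N.
  rewrite -cardsT -(sum_card_pairs_2design _ hl) -sum_nat_const.
  by apply: eq_bigr => X BsX; rewrite setIT hk.
have Bs_gt0 : (0 < #|Bs|)%N by apply/card_gt0P; exists B; apply: orbit_refl.
(* Times [#|Bs|], both sides equal [l * #|T| * #|T|.-1 * m.-1]; [l], possibly zero, is never
   cancelled. *)
apply/eqP; rewrite -(eqn_pmul2l Bs_gt0) !mulnA nBs -[(#|Bs| * k * _)%N]mulnA kBs.
by rewrite -!mulnA [(m.-1 * _)%N]mulnC.
Qed.

(** Group the classes of [P] by the class [D] of [Q] above them: the factor for [D] comes out, and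
    the remaining sum is again [#|B :&: D|]. *)
Lemma sum_card_upclass (R : comNzRingType) (T : finType) (P Q : {set {set T}})
    (B : {set T}) :
    partition P [set: T] -> partition Q [set: T] ->
    (forall A, A \in P -> exists2 E, E \in Q & A \subset E) ->
  \sum_(A in P) #|B :&: A|%:R * #|B :&: upclass Q A|%:R
  = \sum_(D in Q) #|B :&: D|%:R ^+ 2 :> R.
Proof.
move=> pP pQ refPQ.
have upE A D : A \in P -> D \in Q -> (upclass Q A == D) = (A \subset D).
  move=> PA QD; apply/eqP/idP => [<-|]; last exact: upclass_unique pP pQ PA QD.
  have [E QE sAE] := refPQ _ PA.
  by rewrite (upclass_unique pP pQ PA QE sAE).
rewrite (partition_big (upclass Q) (mem Q)) /=; last first.
  move=> A PA; have [E QE sAE] := refPQ _ PA.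
  by rewrite (upclass_unique pP pQ PA QE sAE).
apply: eq_bigr => D QD; rewrite expr2.
rewrite -[in X in X * _](sum_cardI_refinement B pP pQ refPQ QD).
rewrite natr_sum big_distrl /=; apply: eq_big => [A|A /andP[_ /eqP->] //].
by case PA: (A \in P) => //=; apply: upE.
Qed.

Theorem theorem1p5 (s : nat) (e : nat -> nat) (T : finType)
    (C : nat -> {set {set T}}) (k : nat) (B : {set T})
    (G : {group {perm T}}) (Bs : {set {set T}})
    (hs : (2 <= s)%N)
    (he : forall i : nat, (1 <= i <= s)%N -> (2 <= e i)%N)
    (hv : #|T| = (\prod_(1 <= i < s.+1) e i)%N)
    (hC : partition_chain s C)
    (hCe : chain_degrees s e C)
    (hk : #|B| = k)
    (hG : G \subset chain_wreath s C)
    (hBs : Bs = orbit ('P^*)%act G B)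
    (hdes : is_2design k Bs)
    (hbt : block_transitive G Bs)
    (hci : design_chain_imprimitive s G Bs) :
  let x (A : {set T}) : rat := (#|B :&: A|)%:R in
  let r : rat := k%:R * (k%:R - 1) / (#|T|%:R - 1) in
  \sum_(A in C 1%N) x A * (x A - 1) = r * ((e 1%N)%:R - 1)
  /\
  forall i : nat, (2 <= i <= s)%N ->
    \sum_(A in C i.-1) x A * (x (upclass (C i) A) - x A)
    = r * ((e i)%:R - 1) * \prod_(1 <= j < i) (e j)%:R.
Proof.
move=> x r; have [pC C0 Cs precC] := hC.
have mulnP1 n : (n * n.-1)%:R = n%:R * (n%:R - 1) :> rat.
  by case: n => [|n]; rewrite ?mul0r // natrM -[n.+1.-1]/n -[n.+1%:R]natr1 addrK.
(* The common size of the classes of [C i]. *)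
pose m i : rat := \prod_(1 <= j < i.+1) (e j)%:R.
have mE i : m i = (\prod_(1 <= j < i.+1) e j)%N%:R by rewrite natr_prod.
have m_gt0 i : (i <= s)%N -> (0 < \prod_(1 <= j < i.+1) e j)%N.
  move=> le_is; rewrite big_seq prodn_cond_gt0 // => j.
  rewrite mem_index_iota ltnS => /andP[j1 ji].
  by rewrite ltnW // he // j1 (leq_trans ji).
have T_gt1 : (1 < #|T|)%N.
  case: s hs he hv m_gt0 {hC hCe hG hci pC Cs precC} => // s' s2 he' -> mgt.
  rewrite big_nat_recr //= (leq_trans (he' s'.+1 _)) ?leqnn //.
  by rewrite leq_pmull // mgt.
have T1_neq0 : #|T|%:R - 1 != 0 :> rat.
  by rewrite subr_eq0 -[1]/(1%:R) Num.Theory.eqr_nat neq_ltn T_gt1 orbT.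
have pairsE i : (i <= s)%N -> \sum_(A in C i) x A * (x A - 1) = r * (m i - 1).
  move=> le_is.
  have GC : G \subset ('N(C i | 'P^*))%g.
    apply: subset_trans hG _; have lt_is : (i < s.+1)%N by [].
    exact: (bigcap_inf (Ordinal lt_is)).
  rewrite hBs in hdes.
  have := sum_card_pairs_invariant_partition hdes GC (pC i le_is)
            (card_chain_class hC hCe le_is).
  move/(congr1 (fun n => n%:R : rat)); rewrite !natrM natr_sum.
  rewrite -natrM mulnP1 -subn1 natrB 1?ltnW // -subn1 natrB ?m_gt0 // -mE => E.
  apply: (mulIf T1_neq0); rewrite /r mulrAC divfK // -E.
  by congr (_ * _); apply: eq_bigr => A _; rewrite mulnP1.
have sum_x i : (i <= s)%N -> \sum_(A in C i) x A = k%:R.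
  move=> le_is; rewrite -natr_sum -hk -[B in RHS]setIT; congr _%:R.
  rewrite -sum_nat_cardI (set_partition_big _ (pC i le_is)) /=.
  by apply: eq_bigr => A _; rewrite sum_nat_cardI.
(* The summand [k] is the same at every level, so it cancels in the difference. *)
have sqE i : (i <= s)%N -> \sum_(A in C i) x A ^+ 2 = r * (m i - 1) + k%:R.
  move=> le_is; rewrite -pairsE // -(sum_x i le_is) -big_split /=.
  by apply: eq_bigr => A _; rewrite mulrBr mulr1 subrK expr2.
split; first by rewrite pairsE 1?ltnW // /m big_nat1.
case=> // i /andP[i1 lt_is] /=.
have [refC _] := precC i lt_is.
under eq_bigr => A _ do rewrite mulrBr -expr2.
rewrite big_split sumrN /=.
rewrite (sum_card_upclass _ _ (pC i (ltnW lt_is)) (pC _ lt_is) refC).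
rewrite (sqE i.+1) // (sqE i) 1?ltnW // /m big_nat_recr //=.
rewrite -/(m i).
(* What remains is [m i * e i.+1 - m i = m i * (e i.+1 - 1)]. *)
by ring.
Qed.
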